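(* Let $\mathbf J_1=(T_1,S_1)$ and $\mathbf J_2=(T_2,S_2)$ be frames, let $t\colon \mathbf J_1\to\mathbf J_2$ be a homomorphism of frames and let $\mathbf L$ be a sup-semilattice. Then there exists a lax morphism of $F$-sup-semilattices $\mathbf L^t\colon \mathbf L^{\mathbf J_2}\to\mathbf L^{\mathbf J_1}$ such that, for every $x\in L^{T_2}$ and every $i\in T_1$, $(\mathbf L^t(x))(i)=x(t(i))$. Moreover, $\mathbf L^{-}$ (sending $\mathbf J$ to $\mathbf L^{\mathbf J}$ and $t$ to $\mathbf L^t$) is a contravariant functor from the category of frames and frame homomorphisms to the category of $F$-sup-semilattices and lax morphisms.
   Context: A sup-semilattice $\mathbf L=(L,\bigvee)$ is a poset in which every subset has a join; morphisms of sup-semilattices are maps preserving arbitrary joins. An $F$-sup-semilattice is a pair $(\mathbf G,F)$ where $\mathbf G$ is a sup-semilattice and $F\colon G\to G$ satisfies $F(\bigvee X)=\bigvee F(X)$ for all $X\subseteq G$. A lax morphism of $F$-sup-semilattices $(\mathbf G_1,F_1)\to(\mathbf G_2,F_2)$ is a sup-semilattice morphism $f$ with $F_2(f(x))\leq f(F_1(x))$ for all $x\in G_1$. A frame $\mathbf J=(T,S)$ is a set $T$ with a binary relation $S\subseteq T^2$; a homomorphism of frames $(T_1,S_1)\to(T_2,S_2)$ is a map $t\colon T_1\to T_2$ such that $(i,j)\in S_1$ implies $(t(i),t(j))\in S_2$. For a sup-semilattice $\mathbf L$ and a frame $\mathbf J=(T,S)$, $\mathbf L^{\mathbf J}$ is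 the $F$-sup-semilattice $(\mathbf L^T,F^{\mathbf J})$, where $\mathbf L^T$ is the set of maps $T\to L$ with pointwise order and $(F^{\mathbf J}(x))(i)=\bigvee\{x(k)\mid (i,k)\in S\}$ for $x\in L^T$, $i\in T$. *)

(* Defs.v *)
From HB Require Import structures.
From mathcomp Require Import all_boot all_order.
From mathcomp Require Import boolp classical_sets.

Set Implicit Arguments.
Unset Strict Implicit.
Unset Printing Implicit Defensive.

Import Order.TTheory.
Local Open Scope classical_set_scope.

HB.mixin Record hasArbitraryJoins d T of Order.POrder d T := {
  bigjoin : set T -> T;
  bigjoin_isLub : forall X : set T, isLub X (bigjoin X)
}.

#[short(type="supSemilatticeType")]
HB.structure Definition SupSemilattice d :=
  { T of hasArbitraryJoins d T & Order.POrder d T }.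

Section SupSemilatticeTheory.
Context {d : Order.disp_t} {L : supSemilatticeType d}.
Implicit Types (X : set L) (x y : L).

Lemma bigjoin_ub X x : X x -> (x <= bigjoin X)%O.
Proof. by move=> Xx; have [ub _] := bigjoin_isLub X; exact: ub. Qed.

Lemma bigjoin_le X y : (forall x, X x -> (x <= y)%O) -> (bigjoin X <= y)%O.
Proof. by move=> Xy; have [_] := bigjoin_isLub X; apply. Qed.

End SupSemilatticeTheory.

(* The order on T -> L is the pointwise order declared in boolp. *)
Section Power.
Context {T : Type} {d : Order.disp_t} {L : supSemilatticeType d}.

Definition fun_bigjoin (X : set (T -> L)) : T -> L :=
  fun i => bigjoin [set x i | x in X].

Lemma fun_bigjoin_isLub (X : set (T -> L)) : isLub X (fun_bigjoin X).
Proof.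
split=> [x Xx|y Xy]; apply/lefP => i.
  by apply: bigjoin_ub; exists x.
by apply: bigjoin_le => _ [x Xx <-]; move/Xy/lefP: Xx; exact.
Qed.

HB.instance Definition _ :=
  hasArbitraryJoins.Build _ (T -> L) fun_bigjoin_isLub.

End Power.

Definition preserves_joins {d1 d2 : Order.disp_t} {L1 : supSemilatticeType d1}
    {L2 : supSemilatticeType d2} (f : L1 -> L2) : Prop :=
  forall X : set L1, f (bigjoin X) = bigjoin (f @` X).

Lemma preserves_joins_id {d} {L : supSemilatticeType d} :
  preserves_joins (@id L).
Proof. by move=> X; rewrite image_id. Qed.

Lemma preserves_joins_comp {d1 d2 d3} {L1 : supSemilatticeType d1}
    {L2 : supSemilatticeType d2} {L3 : supSemilatticeType d3}
    (g : L2 -> L3) (f : L1 -> L2) :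
  preserves_joins g -> preserves_joins f -> preserves_joins (g \o f).
Proof. by move=> gj fj X; rewrite /= fj gj image_comp. Qed.

Lemma preserves_joins_mono {d1 d2} {L1 : supSemilatticeType d1}
    {L2 : supSemilatticeType d2} (f : L1 -> L2) :
  preserves_joins f -> {homo f : x y / (x <= y)%O}.
Proof.
move=> fj x y xy.
have <- : bigjoin [set x; y] = y.
  apply/eqP; rewrite eq_le; apply/andP; split.
    by apply: bigjoin_le => z [->|->].
  by apply: bigjoin_ub; right.
by rewrite fj; apply: bigjoin_ub; exists x => //; left.
Qed.

Record F_sup_semilattice : Type := FSupSemilattice {
  fsup_disp : Order.disp_t;
  fsup_carrier :> supSemilatticeType fsup_disp;
  fsup_op : fsup_carrier -> fsup_carrier;
  fsup_op_joins : preserves_joins fsup_op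
}.
Arguments fsup_op : clear implicits.

Record lax_morphism (G1 G2 : F_sup_semilattice) : Type := LaxMorphism {
  lax_fun :> G1 -> G2;
  lax_fun_joins : preserves_joins lax_fun;
  lax_fun_le : forall x : G1,
    (fsup_op G2 (lax_fun x) <= lax_fun (fsup_op G1 x))%O
}.

Record frame : Type := Frame {
  frame_carrier :> Type;
  frame_rel : set (frame_carrier * frame_carrier)
}.
Arguments frame_rel : clear implicits.

Record frame_hom (J1 J2 : frame) : Type := FrameHom {
  frame_fun :> J1 -> J2;
  frame_fun_rel : forall i j : J1,
    frame_rel J1 (i, j) -> frame_rel J2 (frame_fun i, frame_fun j)
}.

Section FramePower.
Context {d : Order.disp_t} (L : supSemilatticeType d) (J : frame).

Definition power_op (x : J -> L) : J -> L :=
  fun i => bigjoin [set x k | k in [set k | frame_rel J (i, k)]].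

Lemma power_op_joins : preserves_joins power_op.
Proof.
move=> X; apply/funext => i; apply/eqP; rewrite eq_le; apply/andP; split.
  apply: bigjoin_le => _ [k /= ik <-]; apply: bigjoin_le => _ [x Xx <-].
  apply: (@le_trans _ _ (power_op x i)); first by apply: bigjoin_ub; exists k.
  by apply: bigjoin_ub; exists (power_op x) => //; exists x.
apply: bigjoin_le => _ [_ [x Xx <-] <-]; apply: bigjoin_le => _ [k /= ik <-].
apply: (@le_trans _ _ (bigjoin X k)); first by apply: bigjoin_ub; exists x.
by apply: bigjoin_ub; exists k.
Qed.

Definition frame_power : F_sup_semilattice := FSupSemilattice power_op_joins.

End FramePower.

Record category : Type := Category {
  ob :> Type;
  hom : ob -> ob -> Type;
  idm : forall a, hom a a;
  comp : forall a b c, hom b c -> hom a b -> hom a c;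
  comp_idl : forall a b (f : hom a b), comp (idm b) f = f;
  comp_idr : forall a b (f : hom a b), comp f (idm a) = f;
  comp_assoc : forall a b c e (f : hom a b) (g : hom b c) (h : hom c e),
    comp h (comp g f) = comp (comp h g) f
}.
Arguments hom {_} _ _.
Arguments idm {_} a.
Arguments comp {_ a b c} _ _.

Definition is_contravariant_functor (C D : category) (Fo : C -> D)
    (Fm : forall a b : C, hom a b -> hom (Fo b) (Fo a)) : Prop :=
  (forall a : C, Fm a a (idm a) = idm (Fo a)) /\
  (forall (a b c : C) (f : hom a b) (g : hom b c),
     Fm a c (comp g f) = comp (Fm a b f) (Fm b c g)).
Arguments is_contravariant_functor : clear implicits.

Section FrameCategory.

Lemma frame_hom_ext (J1 J2 : frame) (s t : frame_hom J1 J2) :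
  (forall i, s i = t i) -> s = t.
Proof.
case: s t => [s sP] [t tP] /= /funext st; case: _ / st tP => tP.
by congr FrameHom; exact: Prop_irrelevance.
Qed.

Definition frame_hom_id (J : frame) : frame_hom J J :=
  @FrameHom J J id (fun _ _ ij => ij).

Definition frame_hom_comp (J1 J2 J3 : frame) (s : frame_hom J2 J3)
    (t : frame_hom J1 J2) : frame_hom J1 J3 :=
  @FrameHom J1 J3 (s \o t)
    (fun i j ij => frame_fun_rel s (frame_fun_rel t ij)).

Definition frame_category : category.
Proof.
apply: (@Category frame frame_hom frame_hom_id frame_hom_comp);
  by move=> *; exact: frame_hom_ext.
Defined.

End FrameCategory.

Section FSupCategory.

Lemma lax_morphism_ext (G1 G2 : F_sup_semilattice) (f g : lax_morphism G1 G2) :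
  (forall x, f x = g x) -> f = g.
Proof.
case: f g => [f fj fl] [g gj gl] /= /funext fg; case: _ / fg gj gl => gj gl.
by congr LaxMorphism; exact: Prop_irrelevance.
Qed.

Definition lax_id (G : F_sup_semilattice) : lax_morphism G G :=
  @LaxMorphism G G id preserves_joins_id (fun x => lexx (fsup_op G x)).

Lemma lax_comp_le (G1 G2 G3 : F_sup_semilattice) (g : lax_morphism G2 G3)
    (f : lax_morphism G1 G2) (x : G1) :
  (fsup_op G3 ((g \o f) x) <= (g \o f) (fsup_op G1 x))%O.
Proof.
apply: le_trans (lax_fun_le g (f x)) _.
by apply: (preserves_joins_mono (@lax_fun_joins _ _ g)); exact: lax_fun_le.
Qed.

Definition lax_comp (G1 G2 G3 : F_sup_semilattice) (g : lax_morphism G2 G3)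
    (f : lax_morphism G1 G2) : lax_morphism G1 G3 :=
  @LaxMorphism G1 G3 (g \o f)
    (preserves_joins_comp (@lax_fun_joins _ _ g) (@lax_fun_joins _ _ f))
    (lax_comp_le g f).

Definition F_sup_semilattice_category : category.
Proof.
apply: (@Category F_sup_semilattice lax_morphism lax_id lax_comp);
  by move=> *; exact: lax_morphism_ext.
Defined.

End FSupCategory.

(* Main.v *)
Require Import Defs.
From HB Require Import structures.
From mathcomp Require Import all_boot all_order.
From mathcomp Require Import boolp classical_sets.

(** [L^t] is precomposition with [t]. Joins of maps are pointwise, so it preserves them. It is lax
    because [t] sends successors of [i] to successors of [t i]: the join on the left runs over part
    of the family on the right. Equality can fail, as [t i] may have successors that are not images
    of successors of [i]. *)

Section Reindexing.
Context {d : Order.disp_t} (L : supSemilatticeType d) {J1 J2 : frame}.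
Variable t : frame_hom J1 J2.

Definition reindex (x : J2 -> L) : J1 -> L := fun i => x (t i).

Lemma reindex_joins : preserves_joins reindex.
Proof.
by move=> X; apply/funext => i; congr bigjoin; rewrite image_comp.
Qed.

Lemma reindex_lax (x : frame_power L J2) :
  (fsup_op (frame_power L J1) (reindex x)
    <= reindex (fsup_op (frame_power L J2) x))%O.
Proof.
apply/lefP => i; apply: bigjoin_le => _ [k /= ik <-].
by apply: bigjoin_ub; exists (t k) => //; exact: frame_fun_rel.
Qed.

Definition lax_reindex : lax_morphism (frame_power L J2) (frame_power L J1) :=
  @LaxMorphism (frame_power L J2) (frame_power L J1) _ reindex_joins
    reindex_lax.

End Reindexing.

Theorem theorem3p4 (d : Order.disp_t) (L : supSemilatticeType d) :
  exists Lpow : forall J1 J2 : frame,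
      frame_hom J1 J2 -> lax_morphism (frame_power L J2) (frame_power L J1),
    (forall (J1 J2 : frame) (t : frame_hom J1 J2) (x : J2 -> L) (i : J1),
       Lpow J1 J2 t x i = x (t i)) /\
    is_contravariant_functor frame_category F_sup_semilattice_category
      (frame_power L) Lpow.
Proof.
exists (@lax_reindex d L); split=> //.
(* By extensionality only the underlying maps matter, and for precomposition both functor laws hold
   by computation. *)
by split=> *; apply: lax_morphism_ext.
Qed.
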